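(* Let $n=2^r$ with $r\ge3$ an integer. The $n\times n$ square produced by the Franklin $N-i$ construction is a Franklin square.
   Context: Throughout $n=2^r$, $r\ge3$, $N=n^2+1$, $M=\frac n2N$; $a_{i,j}$ is the entry in row $i$, column $j$ of an $n\times n$ square, rows numbered from top to bottom and columns from left to right. In the sums below, row and column indices are read modulo $n$ (in $\{1,\dots,n\}$). Franklin square. An $n\times n$ matrix such that: (1) every integer from $\{1,2,\dots,n^2\}$ occurs exactly once (so the magic sum is $M=\frac n2 N$); (2) all half rows (first $n/2$ or last $n/2$ entries of a row) and all half columns (first $n/2$ or last $n/2$ entries of a column) add to $M/2$, so all rows and columns add to $M$; (3) all bend diagonals add to $M$, continuously, i.e. for each $c\in\{1,\dots,n\}$ each of the following families of $n$ entries adds to $M$: left, $a_{k,c+k-1}$ and $a_{n+1-k,c+k-1}$, $k=1,\dots,n/2$; right, $a_{k,c-k+1}$ and $a_{n+1-k,c-k+1}$, $k=1,\dots,n/2$; top, $a_{c+k-1,k}$ and $a_{c+k-1,n+1-k}$, $k=1,\dots,n/2$; bottom, $a_{c-k+1,k}$ and $a_{c-k+1,n+1-k}$, $k=1,\dots,n/2$; (4) all $2\times2$ sub-squares add to $2N$, continuously: $a_{i,j}+a_{i+1,j}+a_{i,j+1}+a_{i+1,j+1}=2N$ for all $i,j\in\{1,\dots,n\}$ (indices mod $n$). Up and Down operations. Given a block of $R$ consecutive rows (a part), two columns $C_l$ (the left one) and $C_r$ (the right one), and a starting number $A$: the Up operation places $A,A+1,\dots,A+R-1$ in consecutive rows,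 one number per row, starting at the bottom row of the part and going upwards, alternating between $C_l$ and $C_r$ and starting in $C_l$. The Down operation places $A,A+1,\dots,A+R-1$ in consecutive rows, one number per row, starting at the top row of the part and going downwards, alternating between $C_l$ and $C_r$ and starting in $C_r$. Franklin $N-i$ construction. The left side is columns $1,\dots,n/2$. The Top part is rows $1,\dots,n/4$, the Middle part is rows $n/4+1,\dots,3n/4$, the Bottom part is rows $3n/4+1,\dots,n$. Step 1. For $d=0,1,\dots,n/4-1$ let $C_l$ be column $n/4-d$, $C_r$ be column $n/4+1+d$ (the equidistant columns at distance $d$) and $A=nd+1$. If $d$ is even: apply Up to the Bottom part with starting number $A$, Up to the Top part with starting number $A+n/4$, and Down to the Middle part with starting number $A+n/2$. If $d$ is odd: apply Up to the Middle part with starting number $A$, Down to the Top part with starting number $A+n/2$, and Down to the Bottom part with starting number $A+3n/4$. Step 2. Each empty cell of the left side is filled with $N-x$, where $x$ is the entry in the same row in the equidistant column (columns $n/4-d$ and $n/4+1+d$ are equidistant). Step 3. The right side (columns $n/2+1,\dots,n$) is obtained from the completed left side by interchanging its first $n/4$ columns, as a block and keeping their order, with its last $n/4$ columns; then in odd rows adding $n^2/4$ to each entry of the first half and subtracting $n^2/4$ from each entry of the second half of the resulting row of length $n/2$, and in even rows subtracting $n^2/4$ from each entry of the first half and adding $n^2/4$ to each entry of the second half. *)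

(* Defs.v *)
From mathcomp Require Import all_boot all_order all_algebra.

Set Implicit Arguments.
Unset Strict Implicit.
Unset Printing Implicit Defensive.

Import GRing.Theory.
Local Open Scope ring_scope.

(* All divisions below are exact for n = 2 ^ r with r >= 3. *)
Definition bigN (n : nat) : nat := (n ^ 2 + 1)%N.
Definition magicM (n : nat) : nat := (n %/ 2 * bigN n)%N.

(* Matrix indices are 0-based: the row (or column) numbered k is the ordinal
   of value k - 1.  [ordS] and [ord_pred] are the cyclic successor and
   predecessor on 'I_n, and [rev_ord k] is the row (or column) n + 1 - k. *)

Section FranklinSquare.
Variables (n : nat) (a : 'M[int]_n).

Definition each_once : Prop :=
  forall x : int, 1 <= x <= (n ^ 2)%N%:Z ->
    exists! p : 'I_n * 'I_n, a p.1 p.2 = x.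

Definition half_rows : Prop :=
  forall i : 'I_n,
    \sum_(j < n | (j < n %/ 2)%N) a i j = (magicM n %/ 2)%N%:Z /\
    \sum_(j < n | (n %/ 2 <= j)%N) a i j = (magicM n %/ 2)%N%:Z.

Definition half_columns : Prop :=
  forall j : 'I_n,
    \sum_(i < n | (i < n %/ 2)%N) a i j = (magicM n %/ 2)%N%:Z /\
    \sum_(i < n | (n %/ 2 <= i)%N) a i j = (magicM n %/ 2)%N%:Z.

Definition left_bends : Prop :=
  forall c : 'I_n,
    \sum_(k < n | (k < n %/ 2)%N)
      (a k (iter k (@ordS n) c) + a (rev_ord k) (iter k (@ordS n) c))
    = (magicM n)%:Z.

Definition right_bends : Prop :=
  forall c : 'I_n,
    \sum_(k < n | (k < n %/ 2)%N)
      (a k (iter k (@ord_pred n) c) + a (rev_ord k) (iter k (@ord_pred n) c))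
    = (magicM n)%:Z.

Definition top_bends : Prop :=
  forall c : 'I_n,
    \sum_(k < n | (k < n %/ 2)%N)
      (a (iter k (@ordS n) c) k + a (iter k (@ordS n) c) (rev_ord k))
    = (magicM n)%:Z.

Definition bottom_bends : Prop :=
  forall c : 'I_n,
    \sum_(k < n | (k < n %/ 2)%N)
      (a (iter k (@ord_pred n) c) k + a (iter k (@ord_pred n) c) (rev_ord k))
    = (magicM n)%:Z.

Definition two_by_two : Prop :=
  forall i j : 'I_n,
    a i j + a (ordS i) j + a i (ordS j) + a (ordS i) (ordS j)
    = (2 * bigN n)%N%:Z.

Definition is_franklin_square : Prop :=
  [/\ each_once,
      half_rows /\ half_columns,
      [/\ left_bends, right_bends, top_bends & bottom_bends]
    & two_by_two].

End FranklinSquare.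

(* A partially filled square maps a row number and a column number, both
   1-based, to the content of the cell; [None] is an empty cell. *)

Definition grid := nat -> nat -> option int.

Definition empty_grid : grid := fun _ _ => None.

Definition put (g : grid) (i j : nat) (x : int) : grid :=
  fun i' j' => if (i' == i) && (j' == j) then Some x else g i' j'.

(* First row and number of rows of a block of consecutive rows. *)
Definition part := (nat * nat)%type.

Definition top_part (n : nat) : part := (1, n %/ 4)%N.
Definition middle_part (n : nat) : part := (n %/ 4 + 1, n %/ 2)%N.
Definition bottom_part (n : nat) : part := ((3 * n) %/ 4 + 1, n %/ 4)%N.

Definition up (p : part) (cl cr A : nat) (g : grid) : grid :=
  foldl (fun h t =>
           put h (p.1 + p.2 - 1 - t)%N (if odd t then cr else cl) (A + t)%N%:Z)
        g (iota 0 p.2).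

Definition down (p : part) (cl cr A : nat) (g : grid) : grid :=
  foldl (fun h t =>
           put h (p.1 + t)%N (if odd t then cl else cr) (A + t)%N%:Z)
        g (iota 0 p.2).

Section Construction.
Local Open Scope nat_scope.
Variable n : nat.

Definition fill_pair (g : grid) (d : nat) : grid :=
  let cl := n %/ 4 - d in
  let cr := n %/ 4 + 1 + d in
  let A := n * d + 1 in
  if ~~ odd d then
    let g1 := up (bottom_part n) cl cr A g in
    let g2 := up (top_part n) cl cr (A + n %/ 4) g1 in
    down (middle_part n) cl cr (A + n %/ 2) g2
  else
    let g1 := up (middle_part n) cl cr A g in
    let g2 := down (top_part n) cl cr (A + n %/ 2) g1 in
    down (bottom_part n) cl cr (A + (3 * n) %/ 4) g2.

Definition step1 : grid := foldl fill_pair empty_grid (iota 0 (n %/ 4)).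

(* The equidistant columns n/4 - d and n/4 + 1 + d add up to n/2 + 1. *)
Definition left_side : grid := fun i j =>
  if step1 i j is Some x then Some x
  else omap (fun x : int => ((bigN n)%:Z - x)%R) (step1 i (n %/ 2 + 1 - j)).

Definition swapped_left_side : grid := fun i k =>
  if k <= n %/ 4 then left_side i (k + n %/ 4) else left_side i (k - n %/ 4).

(* Column k of the right side is column n/2 + k of the square. *)
Definition right_side : grid := fun i k =>
  let q : int := (n ^ 2 %/ 4)%N%:Z in
  omap (fun x : int =>
          if odd i then (if k <= n %/ 4 then (x + q)%R else (x - q)%R)
          else (if k <= n %/ 4 then (x - q)%R else (x + q)%R))
       (swapped_left_side i k).

Definition franklin_Ni_grid : grid := fun i j =>
  if j <= n %/ 2 then left_side i j else right_side i (j - n %/ 2).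

End Construction.

(* In particular, the construction leaves no cell empty. *)
Definition produced_by_franklin_Ni (n : nat) (a : 'M[int]_n) : Prop :=
  forall i j : 'I_n, franklin_Ni_grid n i.+1 j.+1 = Some (a i j).

(* Main.v *)
Require Import Defs.
From mathcomp Require Import all_boot all_order all_algebra.
From mathcomp Require Import zify ring.

Set Implicit Arguments.
Unset Strict Implicit.
Unset Printing Implicit Defensive.

Import Order.TTheory GRing.Theory Num.Theory.
Local Open Scope ring_scope.

(** The construction has a closed form from which every property can be read
off.  Write [n = 4m] with [m] even, and number rows and columns from 0.  Then
all entries satisfy
<<
  2 a(i,j) = N + (-1)^i ((-1)^j u(i) - n w(j)),
>>
where [u = row_offset m] and [w = col_offset m] each enumerate the odd integers
strictly between [-n] and [n] ([franklin_Ni_deviation]).  This works because,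
for each pair of equidistant columns, the three Up/Down runs place the numbers
of an interval of length [n] along one and the same zigzag (the left column of
the pair in rows with [i] odd, the right one in the others), and passing from
one pair to the next reverses the order in which the rows are served;
complementing with [N - x] is a change of sign of the deviation from [N/2]; and
the correction by [n^2/4] in the right side is a translation of [w].

Given the closed form, the sums over half rows, half columns and bend diagonals
and the 2 x 2 sums all reduce to cancellations.  Alternating signs kill some
terms one pair at a time; the remaining sums vanish because a sequence of length
[2m] changes sign either under the shift by [m] ([sum_antiperiodic]; as [m]
is even, this shift preserves alternating signs) or under reversal
([sum_antisymmetric]).

Finally the entries lie between 1 and [n^2] and are distinct, hence exhaust that
range.  For distinctness ([deviation_inj]), a deviation is [U - n W] with [U],
[W] odd and [|U| < n], so it determines [U] modulo [2n], thus [U] and [W]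
themselves.  These are [u(i)] and [w(j)] up to signs depending on the parities
of [i] and [j]; two distinct rows with the same [|u|] are [m] apart, so [|U|]
already gives the parity of [i], then [W] gives [j], and [U] gives [i].

The argument applies to every multiple [n = 4m] of 8. *)

(** * The closed form *)

Definition row_offset (m i : nat) : int :=
  if (i < m)%N then - (2 * i%:Z + 1)
  else if (i < 3 * m)%N then 2 * i%:Z + 1 - 2 * m%:Z
  else 4 * m%:Z - 1 - 2 * i%:Z.

Definition col_offset (m j : nat) : int :=
  if (j < m)%N then - (2 * m%:Z + 1 + 2 * j%:Z) else 6 * m%:Z - 1 - 2 * j%:Z.

(** Twice the difference between an entry and the mean value [N / 2]; the
doubling avoids half-integers. *)
Definition deviation (m i j : nat) : int :=
  (-1) ^+ i * ((-1) ^+ j * row_offset m i - 4 * m%:Z * col_offset m j).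

(** * Evaluating the construction cell by cell *)

(** Both a single Up or Down run and [step1] are folds of updates
of a grid.  Seen from one cell, the order of the updates is irrelevant as long
as all those that hit the cell write the same value [x]; here at most one
does. *)
Lemma foldl_gridE (T : eqType) (F : grid -> T -> grid) (hit : pred T)
    (x : int) (s : seq T) (g : grid) (i j : nat) :
    (forall h t, t \in s -> F h t i j = if hit t then Some x else h i j) ->
  foldl F g s i j = if has hit s then Some x else g i j.
Proof.
elim: s g => [//|t s IHs] g FE /=.
rewrite IHs => [|h t' t's]; last by apply: FE; rewrite inE t's orbT.
by rewrite FE ?mem_head //; case: (hit t); case: (has hit s).
Qed.

Lemma upE (p : part) (cl cr A : nat) (g : grid) (i j : nat) :
  up p cl cr A g i j =
  if (p.1 <= i < p.1 + p.2)%N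
     && (j == if odd (p.1 + p.2 - 1 - i) then cr else cl)
  then Some (A + (p.1 + p.2 - 1 - i))%N%:Z else g i j.
Proof.
pose hit t := (i == p.1 + p.2 - 1 - t)%N && (j == if odd t then cr else cl).
rewrite /up (@foldl_gridE _ _ hit (A + (p.1 + p.2 - 1 - i))%N%:Z).
  congr (if _ then _ else _); apply/hasP/andP => [[t]|[i_in jE]].
    rewrite mem_iota /hit => t_lt /andP [/eqP -> /eqP ->].
    have -> : (p.1 + p.2 - 1 - (p.1 + p.2 - 1 - t) = t)%N by lia.
    by split; first lia.
  exists (p.1 + p.2 - 1 - i)%N; first by rewrite mem_iota; lia.
  by rewrite /hit jE andbT; lia.
move=> h t; rewrite mem_iota /put /hit => t_lt; case: eqP => //= ->.
by case: eqP => // _; congr (Some (Posz _)); lia.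
Qed.

Lemma downE (p : part) (cl cr A : nat) (g : grid) (i j : nat) :
  down p cl cr A g i j =
  if (p.1 <= i < p.1 + p.2)%N && (j == if odd (i - p.1) then cl else cr)
  then Some (A + (i - p.1))%N%:Z else g i j.
Proof.
pose hit t := (i == p.1 + t)%N && (j == if odd t then cl else cr).
rewrite /down (@foldl_gridE _ _ hit (A + (i - p.1))%N%:Z).
  congr (if _ then _ else _); apply/hasP/andP => [[t]|[i_in jE]].
    rewrite mem_iota /hit => t_lt /andP [/eqP -> /eqP ->].
    have -> : (p.1 + t - p.1 = t)%N by lia.
    by split; first lia.
  exists (i - p.1)%N; first by rewrite mem_iota; lia.
  by rewrite /hit jE andbT; lia.
move=> h t; rewrite mem_iota /put /hit => t_lt; case: eqP => //= ->.
by case: eqP => // _; congr (Some (Posz _)); lia.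
Qed.

(** The number that [step1] puts in row [i] of the pair of columns at distance
[d].  Exchanging the parity of [d] maps the last summand [y] to
[4 * m - 1 - y]. *)
Definition placed (m i d : nat) : nat :=
  (4 * m * d + 1 +
   if odd d then
     if i < m then 2 * m + i else if i < 3 * m then 3 * m - 1 - i else i
   else
     if i < m then 2 * m - 1 - i else if i < 3 * m then m + i
     else 4 * m - 1 - i)%N.

Lemma placed_deviation (m i d : nat) : (i < 4 * m)%N ->
  2 * (placed m i d)%:Z = (bigN (4 * m))%:Z
    + 4 * m%:Z * (2 * d%:Z + 1 - 4 * m%:Z) + (-1) ^+ d * row_offset m i.
Proof.
move=> i_lt; rewrite /placed /row_offset /bigN -signr_odd; case: (odd d);
case: ltnP => ?; try (case: ltnP => ?); rewrite /=; nia.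
Qed.

(** Although Up starts in the left column and Down in the right one, from
opposite ends of the parts, all the runs agree on the column used in a given
row: it depends on the parity of the row only, because [m] is even and the
boundaries of the parts are multiples of [m]. *)
Lemma fill_pairE (m d i j : nat) (g : grid) : ~~ odd m -> (i < 4 * m)%N ->
  fill_pair (4 * m) g d i.+1 j =
  if j == (if odd i then m - d else m + 1 + d)%N
  then Some (placed m i d)%:Z else g i.+1 j.
Proof.
move=> m_even i_lt.
have n4 : (4 * m %/ 4 = m)%N by lia.
have n2 : (4 * m %/ 2 = 2 * m)%N by lia.
have n34 : (3 * (4 * m) %/ 4 = 3 * m)%N by lia.
have top_in : (0 < i.+1 < 1 + m)%N = (i < m)%N by lia.
have mid_in : (m + 1 <= i.+1 < m + 1 + 2 * m)%N = (~~ (i < m) && (i < 3 * m))%N.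
  by lia.
have bot_in : (3 * m + 1 <= i.+1 < 3 * m + 1 + m)%N = ~~ (i < 3 * m)%N by lia.
have colE b c c' : b = odd i ->
  (j == (if b then c else c'))%N = (j == if odd i then c else c')%N by move->.
have colNE b c c' : b = ~~ odd i ->
  (j == (if b then c' else c))%N = (j == if odd i then c else c')%N.
  by move=> ->; case: (odd i).
rewrite /fill_pair /placed n4 n2 n34.
case: (odd d); rewrite /= ?upE ?downE ?upE ?downE;
  rewrite /top_part /middle_part /bottom_part n4 n2 n34;
  rewrite ?top_in mid_in bot_in /=.
(* Exactly one of the three runs reaches row [i]. *)
all: have i_cases : (i < m)%N -> (i < 3 * m)%N by lia.
all: have [i_top|i_top] := ltnP i m;
  [rewrite i_cases //=|have [i_bot|i_bot] := ltnP i (3 * m)];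
  rewrite ?ltnS ?i_top /=.
all: first [rewrite colE; last by lia | rewrite colNE; last by lia].
all: congr (if _ then Some (Posz _) else _); lia.
Qed.

Lemma step1E (m i j : nat) : ~~ odd m -> (i < 4 * m)%N ->
  step1 (4 * m) i.+1 j =
  if (if odd i then 0 < j <= m else m < j <= 2 * m)%N
  then Some (placed m i (if odd i then m - j else j - m.+1))%N%:Z else None.
Proof.
move=> m_even i_lt; have n4 : (4 * m %/ 4 = m)%N by lia.
pose hit d := (j == if odd i then m - d else m + 1 + d)%N.
rewrite /step1 n4 (@foldl_gridE _ _ hit
  (placed m i (if odd i then m - j else j - m.+1))%N%:Z).
  rewrite /empty_grid; congr (if _ then _ else _).
  apply/hasP/idP => [[d]|j_in].
    by rewrite mem_iota /hit; case: (odd i) => d_lt /eqP ->; lia.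
  exists (if odd i then m - j else j - m.+1)%N; move: j_in;
    by rewrite ?mem_iota /hit; case: (odd i); lia.
move=> g d; rewrite mem_iota => d_lt; rewrite fill_pairE // /hit.
case: eqP => // ->; congr (Some (Posz (placed _ _ _))).
by case: (odd i); lia.
Qed.

(** A cell filled by an Up or Down run has deviation given by
[placed_deviation]; one filled by complementation has the opposite of that of
its mirror image.  Which of the two occurs depends on the parity of [i] and on
the half of the left side that contains [j]; multiplied by [(-1) ^ d], the
resulting sign is [(-1) ^ (i + j)] in both halves. *)
Lemma left_side_deviation (m i j : nat) :
    ~~ odd m -> (i < 4 * m)%N -> (j < 2 * m)%N ->
  exists2 x : int, left_side (4 * m) i.+1 j.+1 = Some x
    & 2 * x = (bigN (4 * m))%:Z + deviation m i j.
Proof.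
move=> m_even i_lt j_lt; rewrite /left_side !step1E //.
have n2 : (4 * m %/ 2 = 2 * m)%N by lia.
rewrite n2 /deviation -(signr_odd _ i) -(signr_odd _ j).
have placedE d := placed_deviation d i_lt.
case: ifP => [j_in|j_out].
  eexists; first by [].
  rewrite placedE -[in LHS]signr_odd /col_offset.
  case: ifP j_in => i_odd j_in.
    have -> : (j < m)%N by lia.
    have -> : (m - j.+1)%N%:Z = m%:Z - j%:Z - 1 by lia.
    have -> : odd (m - j.+1) = ~~ odd j by lia.
    by case: (odd j) => /=; ring.
  have -> : (j < m)%N = false by lia.
  have -> : (j.+1 - m.+1)%N%:Z = j%:Z - m%:Z by lia.
  have -> : odd (j.+1 - m.+1) = odd j by lia.
  by case: (odd j) => /=; ring.
rewrite ifT; last by move: j_out; case: (odd i); lia.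
eexists; first by [].
rewrite mulrBr placedE -[in LHS]signr_odd /col_offset.
case: ifP j_out => i_odd j_out.
  have -> : (j < m)%N = false by lia.
  have -> : (m - (2 * m + 1 - j.+1))%N%:Z = j%:Z - m%:Z by lia.
  have -> : odd (m - (2 * m + 1 - j.+1)) = odd j by lia.
  by case: (odd j) => /=; ring.
have -> : (j < m)%N by lia.
have -> : (2 * m + 1 - j.+1 - m.+1)%N%:Z = m%:Z - j%:Z - 1 by lia.
have -> : odd (2 * m + 1 - j.+1 - m.+1) = ~~ odd j by lia.
by case: (odd j) => /=; ring.
Qed.

(** In the right side the swap of the two quarters moves columns by [m] or
[3 * m], and the corrections by [n ^ 2 / 4] restore the single formula
[6 * m - 1 - 2 * j] for the column offset. *)
Lemma franklin_Ni_deviation (m i j : nat) :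
    ~~ odd m -> (i < 4 * m)%N -> (j < 4 * m)%N ->
  exists2 x : int, franklin_Ni_grid (4 * m) i.+1 j.+1 = Some x
    & 2 * x = (bigN (4 * m))%:Z + deviation m i j.
Proof.
move=> m_even i_lt j_lt; rewrite /franklin_Ni_grid.
have n2 : (4 * m %/ 2 = 2 * m)%N by lia.
have n4 : (4 * m %/ 4 = m)%N by lia.
have q4 : ((4 * m) ^ 2 %/ 4)%N%:Z = 4 * m%:Z * m%:Z by nia.
rewrite n2; case: ltnP => j_half; first exact: left_side_deviation.
rewrite /right_side /swapped_left_side n4 q4 /=.
have -> : (j.+1 - 2 * m)%N = (j - 2 * m).+1 by lia.
have sgnE k : odd k = odd j -> (-1) ^+ k = (-1) ^+ j :> int.
  by move=> kj; rewrite -signr_odd kj signr_odd.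
case: ifP => k_lt.
  have jm_lt : (j - m < 2 * m)%N by lia.
  have -> : ((j - 2 * m).+1 + m)%N = (j - m).+1 by lia.
  have [x -> xE] := left_side_deviation m_even i_lt jm_lt.
  eexists; first by [].
  have colE : col_offset m (j - m) = col_offset m j + 2 * m%:Z.
    by rewrite /col_offset !ifF; lia.
  rewrite fun_if !mulrDr xE /deviation (sgnE (j - m)%N); last by lia.
  by rewrite colE -(signr_odd _ i) /=; case: (odd i) => /=; ring.
have jm_lt : (j - 3 * m < 2 * m)%N by lia.
have -> : ((j - 2 * m).+1 - m)%N = (j - 3 * m).+1 by lia.
have [x -> xE] := left_side_deviation m_even i_lt jm_lt.
eexists; first by [].
have colE : col_offset m (j - 3 * m) = col_offset m j - 2 * m%:Z.
  by rewrite /col_offset ifT ?ifF; lia.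
rewrite fun_if !mulrDr xE /deviation (sgnE (j - 3 * m)%N); last by lia.
by rewrite colE -(signr_odd _ i) /=; case: (odd i) => /=; ring.
Qed.

(** * Vanishing sums *)

Lemma sum_antiperiodic (m : nat) (F : nat -> int) :
    (forall k, (k < m)%N -> F (k + m)%N = - F k) ->
  \sum_(0 <= k < 2 * m) F k = 0.
Proof.
move=> FE; rewrite mul2n -addnn (big_cat_nat (n := m)) ?leq_addl //=.
rewrite -{2}[m]add0n big_addn addnK -big_split big_nat /=.
by apply: big1 => k k_lt; rewrite FE ?addrN.
Qed.

Lemma sum_antisymmetric (n : nat) (F : nat -> int) :
    (forall k, (k < n)%N -> F (n - k.+1)%N = - F k) ->
  \sum_(0 <= k < n) F k = 0.
Proof.
move=> FE; suff : \sum_(0 <= k < n) F k = - \sum_(0 <= k < n) F k by lia.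
rewrite {1}big_nat_rev big_nat -sumrN [RHS]big_nat.
by apply: eq_bigr => k k_lt; rewrite add0n FE.
Qed.

Lemma sum_first_half (m : nat) (F : 'I_(4 * m) -> int) (G : nat -> int)
    (c : int) :
    (forall k : 'I_(4 * m), (k < 2 * m)%N -> 2 * F k = c + G k) ->
    \sum_(0 <= k < 2 * m) G k = 0 ->
  \sum_(k < 4 * m | (k < 2 * m)%N) F k = m%:Z * c.
Proof.
move=> FE G0; apply: (mulfI (x := 2)) => //; rewrite mulr_sumr.
rewrite (eq_bigr (fun k : 'I_(4 * m) => c + G k)); last exact: FE.
have half_le : (2 * m <= 4 * m)%N by lia.
rewrite -(big_ord_widen_cond (4 * m) predT (fun k => c + G k)) //.
rewrite -(big_mkord predT (fun k => c + G k)) big_split /= G0 addr0.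
by rewrite sumr_const_nat subn0 -mulr_natr; lia.
Qed.

Lemma sum_second_half (m : nat) (F : 'I_(4 * m) -> int) (G : nat -> int)
    (c : int) :
    (forall k : 'I_(4 * m), (2 * m <= k)%N -> 2 * F k = c + G k) ->
    \sum_(0 <= k < 2 * m) G (k + 2 * m)%N = 0 ->
  \sum_(k < 4 * m | (2 * m <= k)%N) F k = m%:Z * c.
Proof.
move=> FE G0; apply: (mulfI (x := 2)) => //; rewrite mulr_sumr.
rewrite (eq_bigr (fun k : 'I_(4 * m) => c + G k)); last exact: FE.
rewrite -(big_geq_mkord (2 * m) (4 * m) predT (fun k => c + G k)).
rewrite -{1}[(2 * m)%N]add0n big_addn -mulnBl mul2n -addnn.
rewrite addnn -mul2n big_split /= G0 addr0.
by rewrite sumr_const_nat subn0 -mulr_natr; lia.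
Qed.

(** * Symmetries of the offsets *)

Lemma signr_parity (b : bool) (k l : nat) :
  odd k = b (+) odd l -> (-1) ^+ k = (-1) ^+ b * (-1) ^+ l :> int.
Proof. by move=> klE; rewrite -signr_odd klE signr_addb signr_odd. Qed.

(** Each half of the rows splits into two blocks of [m] rows carrying opposite
offsets; this makes the half columns balanced. *)
Lemma row_offset_shift (m i : nat) :
    (i < m)%N || (2 * m <= i < 3 * m)%N ->
  row_offset m (i + m) = - row_offset m i.
Proof. by rewrite /row_offset; do ![case: ifP => ?]; lia. Qed.

(** Along a left or right bend only this difference of the offsets of two mirror
rows survives; being antiperiodic, it sums to zero. *)
Lemma row_offset_bend (m k : nat) : (k < m)%N ->
  row_offset m (k + m) - row_offset m (4 * m - (k + m).+1)
  = - (row_offset m k - row_offset m (4 * m - k.+1)).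
Proof. by rewrite /row_offset; do ![case: ifP => ?]; lia. Qed.

Lemma col_offset_rev (m j : nat) : (j < 2 * m)%N ->
  col_offset m (2 * m - j.+1) = - col_offset m j.
Proof. by rewrite /col_offset; do ![case: ifP => ?]; lia. Qed.

Lemma col_offset_rev_right (m j : nat) : (j < 2 * m)%N ->
  col_offset m (2 * m - j.+1 + 2 * m) = - col_offset m (j + 2 * m).
Proof. by rewrite /col_offset; do ![case: ifP => ?]; lia. Qed.

(** The analogue for top and bottom bends, where it is a sum over two mirror
columns that survives, with alternating signs. *)
Lemma col_offset_bend (m k : nat) : (k < m)%N ->
  col_offset m (k + m) + col_offset m (4 * m - (k + m).+1)
  = - (col_offset m k + col_offset m (4 * m - k.+1)).
Proof. by rewrite /col_offset; do ![case: ifP => ?]; lia. Qed.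

(** * Distinctness of the entries *)

Lemma row_offset_bound (m i : nat) : (i < 4 * m)%N ->
  `|row_offset m i| < 4 * m%:Z.
Proof. by rewrite /row_offset; do ![case: ifP => ?]; lia. Qed.

Lemma col_offset_bound (m j : nat) : (j < 4 * m)%N ->
  `|col_offset m j| < 4 * m%:Z.
Proof. by rewrite /col_offset; case: ifP => ?; lia. Qed.

Lemma row_offset_inj (m i i' : nat) : (i < 4 * m)%N -> (i' < 4 * m)%N ->
  row_offset m i = row_offset m i' -> i = i'.
Proof. by rewrite /row_offset; do ![case: ifP => ?]; lia. Qed.

Lemma col_offset_inj (m j j' : nat) : (j < 4 * m)%N -> (j' < 4 * m)%N ->
  col_offset m j = col_offset m j' -> j = j'.
Proof. by rewrite /col_offset; do ![case: ifP => ?]; lia. Qed.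

Lemma odd_col_offset (m j : nat) : exists x : int, col_offset m j = 2 * x + 1.
Proof.
by exists (if (j < m)%N then - (m%:Z + 1 + j%:Z) else 3 * m%:Z - 1 - j%:Z);
  rewrite /col_offset; case: ifP => _; lia.
Qed.

(** Rows with opposite offsets are exactly [m] apart, and [m] is even. *)
Lemma eq_odd_row_offset (m i i' : nat) (b b' : bool) : ~~ odd m ->
    (i < 4 * m)%N -> (i' < 4 * m)%N ->
    (-1) ^+ b * row_offset m i = (-1) ^+ b' * row_offset m i' ->
  odd i = odd i'.
Proof.
move=> m_even i_lt i'_lt; have [q mE] : exists q, m = (2 * q)%N.
  by exists m./2; lia.
by rewrite /row_offset; case: b; case: b'; do ![case: ifP => ?] => /=; lia.
Qed.

(** The deviation is a number [U - 4 * m * W] with [U] and [W] odd and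
[`|U| < 4 * m]: reduction modulo [8 * m] separates [U] from [W]. *)
Lemma deviation_inj (m i j i' j' : nat) : ~~ odd m ->
    (i < 4 * m)%N -> (j < 4 * m)%N -> (i' < 4 * m)%N -> (j' < 4 * m)%N ->
    deviation m i j = deviation m i' j' ->
  i = i' /\ j = j'.
Proof.
move=> m_even i_lt j_lt i'_lt j'_lt devE.
pose u (i j : nat) : int := (-1) ^+ (odd i (+) odd j) * row_offset m i.
pose w (i j : nat) : int := (-1) ^+ odd i * col_offset m j.
have dev_uw k l : deviation m k l = u k l - 4 * m%:Z * w k l.
  by rewrite /deviation /u /w signr_addb !signr_odd; ring.
have u_lt k l : (k < 4 * m)%N -> `|u k l| < 4 * m%:Z.
  by move=> k_lt; rewrite /u normrM normr_sign mul1r row_offset_bound.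
have w_odd k l : exists x : int, w k l = 2 * x + 1.
  rewrite /w; have [x ->] := odd_col_offset m l.
  by case: (odd k); [exists (- x - 1)|exists x]; rewrite /=; lia.
have [uE wE] : u i j = u i' j' /\ w i j = w i' j'.
  have [[x wE] [x' wE']] := (w_odd i j, w_odd i' j').
  move: devE (u_lt i j i_lt) (u_lt i' j' i'_lt); rewrite !dev_uw wE wE'.
  move: (u i j) (u i' j') => U U' UE U_lt U'_lt.
  have UxE : U - U' = 8 * m%:Z * (x - x') by lia.
  have [x_lt|x_gt|xE] := ltgtP x x'.
  - have : 8 * m%:Z * (x - x') <= 8 * m%:Z * -1 by apply: ler_wpM2l; lia.
    by lia.
  - have : 8 * m%:Z * 1 <= 8 * m%:Z * (x - x') by apply: ler_wpM2l; lia.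
    by lia.
  by move: UxE; rewrite xE subrr mulr0; lia.
(* The parities of [i] and then of [j] must be known before the signs in
   [w] and [u] can be cancelled. *)
have iE := eq_odd_row_offset m_even i_lt i'_lt uE.
have sign_cancel b : injective ( *%R ((-1) ^+ nat_of_bool b) : int -> int).
  by apply: mulfI; rewrite signr_eq0.
have jE : j = j'.
  by move: wE; rewrite /w iE => /sign_cancel; apply: col_offset_inj.
by move: uE; rewrite /u iE jE => /sign_cancel /row_offset_inj ->.
Qed.

(** * The Franklin properties *)

Lemma odd_ordS (m : nat) (i : 'I_(4 * m)) : odd (ordS i) = ~~ odd i.
Proof. by rewrite /= odd_mod ?oddM. Qed.

Lemma odd_ord_pred (m : nat) (i : 'I_(4 * m)) : odd (ord_pred i) = ~~ odd i.
Proof. by rewrite /= odd_mod ?oddM //; have := ltn_ord i; lia. Qed.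

Section Franklin.
Variables (m : nat) (a : 'M[int]_(4 * m)).
Hypothesis aE : forall i j, 2 * a i j = (bigN (4 * m))%:Z + deviation m i j.

Let half_n : (4 * m %/ 2 = 2 * m)%N.
Proof. by lia. Qed.

Let half_sum : (magicM (4 * m) %/ 2)%N%:Z = m%:Z * (bigN (4 * m))%:Z.
Proof.
rewrite /magicM half_n -PoszM; congr Posz.
by rewrite -mulnA -[X in (X %/ _)%N]mulnC mulnK.
Qed.

Lemma half_rows_of_deviation : half_rows a.
Proof.
move=> i; rewrite half_n half_sum.
split; [apply: (sum_first_half (G := deviation m i)) => [j _|]
       |apply: (sum_second_half (G := deviation m i)) => [j _|]];
  rewrite ?aE //; apply: sum_antisymmetric => j j_lt; rewrite /deviation.
  rewrite col_offset_rev //.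
  by rewrite (@signr_parity true (2 * m - j.+1) j) /=; [ring|lia].
rewrite col_offset_rev_right //.
rewrite (@signr_parity true (2 * m - j.+1 + 2 * m) (j + 2 * m)) /=.
  by ring.
by lia.
Qed.

Lemma half_columns_of_deviation : ~~ odd m -> half_columns a.
Proof.
move=> m_even j; rewrite half_n half_sum.
have devE i : deviation m i j =
    (-1) ^+ j * ((-1) ^+ i * row_offset m i)
    + (-1) ^+ i * (- 4 * m%:Z * col_offset m j).
  by rewrite /deviation; ring.
split; [apply: (sum_first_half (G := fun i => deviation m i j)) => [i _|]
       |apply: (sum_second_half (G := fun i => deviation m i j)) => [i _|]];
  rewrite ?aE //; under eq_bigr => i _ do rewrite devE;
  rewrite big_split /= -mulr_sumr -mulr_suml.
  rewrite sum_antiperiodic => [|i i_lt]; last first.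
    rewrite row_offset_shift ?i_lt //.
    by rewrite (@signr_parity false (i + m) i) /=; [ring|lia].
  rewrite sum_antisymmetric => [|i i_lt]; first by ring.
  by rewrite (@signr_parity true (2 * m - i.+1) i) /=; [ring|lia].
rewrite sum_antiperiodic => [|i i_lt]; last first.
  rewrite addnAC row_offset_shift; last by lia.
  by rewrite (@signr_parity false (i + 2 * m + m) (i + 2 * m)) /=; [ring|lia].
rewrite sum_antisymmetric => [|i i_lt]; first by ring.
rewrite (@signr_parity true (2 * m - i.+1 + 2 * m) (i + 2 * m)) /=.
  by ring.
by lia.
Qed.

(** Left and right bends, and likewise top and bottom ones, differ only in the
direction of the cyclic step, and only the effect of that step on parities
enters the sums. *)
Section Bends.
Variable step : 'I_(4 * m) -> 'I_(4 * m).
Hypothesis odd_step : forall i, odd (step i) = ~~ odd i.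

Let signr_iter (c : 'I_(4 * m)) (k : nat) :
  (-1) ^+ iter k step c = (-1) ^+ c * (-1) ^+ k :> int.
Proof.
elim: k => [|k IHk]; first by rewrite mulr1.
rewrite iterS (@signr_parity true _ (iter k step c)) ?odd_step //.
by rewrite IHk exprS; ring.
Qed.

Let magicM_double : (magicM (4 * m))%:Z = m%:Z * (2 * (bigN (4 * m))%:Z).
Proof. by rewrite /magicM half_n; lia. Qed.

(** Rows [k] and [n - 1 - k] have opposite parities, so their [col_offset]
terms in a common column cancel. *)
Lemma row_bends_of_deviation (c : 'I_(4 * m)) :
  \sum_(k < 4 * m | (k < 4 * m %/ 2)%N)
    (a k (iter k step c) + a (rev_ord k) (iter k step c))
  = (magicM (4 * m))%:Z.
Proof.
rewrite half_n magicM_double.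
apply: (sum_first_half (G := fun k =>
  (-1) ^+ c * (row_offset m k - row_offset m (4 * m - k.+1)))).
  move=> k k_lt; rewrite mulrDr !aE /deviation signr_iter /=.
  rewrite (@signr_parity true (4 * m - k.+1) k) /=; last by lia.
  by rewrite -(signr_odd _ k); case: (odd k) => /=; ring.
rewrite -mulr_sumr sum_antiperiodic ?mulr0 // => k k_lt.
exact: row_offset_bend.
Qed.

(** Columns [k] and [n - 1 - k] have opposite parities, so their [row_offset]
terms in a common row cancel. *)
Lemma column_bends_of_deviation (c : 'I_(4 * m)) : ~~ odd m ->
  \sum_(k < 4 * m | (k < 4 * m %/ 2)%N)
    (a (iter k step c) k + a (iter k step c) (rev_ord k))
  = (magicM (4 * m))%:Z.
Proof.
move=> m_even; rewrite half_n magicM_double.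
apply: (sum_first_half (G := fun k =>
  - ((-1) ^+ c * 4 * m%:Z)
  * ((-1) ^+ k * (col_offset m k + col_offset m (4 * m - k.+1))))).
  move=> k k_lt; rewrite mulrDr !aE /deviation signr_iter /=.
  rewrite (@signr_parity true (4 * m - k.+1) k) /=; last by lia.
  by ring.
rewrite -mulr_sumr sum_antiperiodic ?mulr0 // => k k_lt.
by rewrite col_offset_bend // (@signr_parity false (k + m) k) /=; [ring|lia].
Qed.

End Bends.

(** Neighbouring columns cancel the [row_offset] terms and neighbouring rows
the [col_offset] terms, also across the border since the order is even. *)
Lemma two_by_two_of_deviation : two_by_two a.
Proof.
move=> i j; apply: (mulfI (x := 2)) => //.
rewrite !mulrDr !aE /deviation (@signr_parity true (ordS i) i) ?odd_ordS //.
rewrite (@signr_parity true (ordS j) j) ?odd_ordS //.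
by rewrite PoszM; ring.
Qed.

Lemma entry_bounds (i j : 'I_(4 * m)) : 0 < a i j <= ((4 * m) ^ 2)%N%:Z.
Proof.
have [u_lt w_lt] :=
  (row_offset_bound (ltn_ord i), col_offset_bound (ltn_ord j)).
have := aE i j; rewrite /deviation /bigN -(signr_odd _ i) -(signr_odd _ j).
by case: (odd i); case: (odd j) => /=; nia.
Qed.

Lemma each_once_of_deviation : ~~ odd m -> each_once a.
Proof.
move=> m_even.
(* An injective map between finite types of the same size is onto. *)
have rank_lt (p : 'I_(4 * m) * 'I_(4 * m)) :
    (`|a p.1 p.2 - 1| < (4 * m) ^ 2)%N.
  by have := entry_bounds p.1 p.2; lia.
pose rank p := Ordinal (rank_lt p).
have rank_inj : injective rank.
  move=> [i j] [i' j'] /(congr1 val) /= rankE.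
  have [i_b i'_b] := (entry_bounds i j, entry_bounds i' j').
  have devE : deviation m i j = deviation m i' j'.
    by have := aE i j; have := aE i' j'; lia.
  have [] := deviation_inj m_even _ _ _ _ devE; try exact: ltn_ord.
  by move=> /val_inj -> /val_inj ->.
have [|inv _ invK] := inj_card_bij rank_inj.
  by rewrite card_prod !card_ord mulnn.
move=> x x_in; have x_lt : (`|x - 1| < (4 * m) ^ 2)%N by lia.
exists (inv (Ordinal x_lt)); split.
  have := congr1 val (invK (Ordinal x_lt)).
  by have := entry_bounds (inv (Ordinal x_lt)).1 (inv (Ordinal x_lt)).2;
    rewrite /=; lia.
move=> p pE; apply: rank_inj; rewrite invK; apply: val_inj.
by rewrite /= pE.
Qed.

End Franklin.

Theorem franklin_Ni_square (m : nat) : ~~ odd m ->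
  exists a : 'M[int]_(4 * m), produced_by_franklin_Ni a /\ is_franklin_square a.
Proof.
move=> m_even.
pose a : 'M[int]_(4 * m) :=
  \matrix_(i, j) odflt 0 (franklin_Ni_grid (4 * m) i.+1 j.+1).
have gridE (i j : 'I_(4 * m)) :=
  franklin_Ni_deviation m_even (ltn_ord i) (ltn_ord j).
have aE i j : 2 * a i j = (bigN (4 * m))%:Z + deviation m i j.
  by rewrite mxE; have [x -> ->] := gridE i j.
exists a; split; first by move=> i j; rewrite mxE; have [x ->] := gridE i j.
have ordS_odd := @odd_ordS m; have ord_pred_odd := @odd_ord_pred m.
split.
- exact: each_once_of_deviation aE m_even.
- split; first exact: half_rows_of_deviation.
  exact: half_columns_of_deviation aE m_even.
- split=> c.
  + exact: (row_bends_of_deviation aE ordS_odd c).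
  + exact: (row_bends_of_deviation aE ord_pred_odd c).
  + exact: (column_bends_of_deviation aE ordS_odd c m_even).
  + exact: (column_bends_of_deviation aE ord_pred_odd c m_even).
- exact: two_by_two_of_deviation.
Qed.

Theorem proposition2p1 (r : nat) (hr : (3 <= r)%N) :
  exists a : 'M[int]_(2 ^ r),
    produced_by_franklin_Ni a /\ is_franklin_square a.
Proof.
have -> : (2 ^ r = 4 * 2 ^ (r - 2))%N by rewrite -(expnD 2 2) subnKC // ltnW.
by apply: franklin_Ni_square; rewrite oddX; lia.
Qed.
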